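(* Let $$f(x)=\sum_{i=1}^n \pi_i\,\varphi_\Sigma(x-\mu_i),\qquad x\in\mathbb{R}^d,\qquad \pi_i>0,\quad \sum_{i=1}^n\pi_i=1,\quad \Sigma\succ0,$$ with $\mu_1,\dots,\mu_n\in\mathbb{R}^d$. Define posterior weights $$w_i(x)=\frac{\pi_i\varphi_\Sigma(x-\mu_i)}{f(x)},\qquad \bar\mu_w(x)=\sum_i w_i(x)\mu_i,$$ and the weighted covariance matrix of component means $$C_w(x)=\sum_i w_i(x)\{\mu_i-\bar\mu_w(x)\}\{\mu_i-\bar\mu_w(x)\}^T.$$ Then $$\nabla^2\log f(x)=-\Sigma^{-1}+\Sigma^{-1}C_w(x)\Sigma^{-1}.$$ Consequently, $f$ is log-concave if $C_w(x)\preceq\Sigma$ for all $x$, and strictly log-concave if $C_w(x)\prec\Sigma$ for all $x$. In particular, if there is a point $c\in\mathbb{R}^d$ such that $$\max_i \|\Sigma^{-1/2}(\mu_i-c)\|^2<1,$$ then $f$ is strictly log-concave. The following consequences hold for points $X_1,\dots,X_n\in\mathbb{R}^d$. 1. For the heat-flow kernel density estimate $$\widehat u_t(x)=\frac1n\sum_{i=1}^n\varphi_{tI_d}(x-X_i),\qquad t>0,$$ if $\max_i\|X_i-c\|^2\le R^2$ (for some $c\in\mathbb{R}^d$ and $R\ge 0$), then $\widehat u_t$ is strictly log-concave for every $t>R^2$. 2. Let $\bar X=\frac1n\sum_{i=1}^n X_i$ and $S=\frac1n\sum_{i=1}^n(X_i-\bar X)(X_i-\bar X)^T$, assume $S\succ0$,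 and consider the Ornstein--Uhlenbeck path $$g_t(x)=\frac1n\sum_{i=1}^n \varphi_{(1-e^{-2t})S}\bigl(x-\bar X-e^{-t}(X_i-\bar X)\bigr),\qquad t>0.$$ Define $$R_S^2=\max_i (X_i-\bar X)^T S^{-1}(X_i-\bar X).$$ Then $g_t$ is strictly log-concave whenever $$t>\tfrac12\log(1+R_S^2).$$ At those times (i.e. for $\widehat u_t$ with $t>R^2$ and for $g_t$ with $t>\tfrac12\log(1+R_S^2)$) the density has a unique mode, and all its positive-level superlevel sets $\{x:\text{density}(x)\ge\lambda\}$, $\lambda>0$, are convex.
   Context: For a symmetric positive definite $d\times d$ matrix $\Sigma$, $\varphi_\Sigma$ denotes the density on $\mathbb{R}^d$ of the Gaussian distribution with mean $0$ and covariance $\Sigma$. $I_d$ is the $d\times d$ identity matrix. $A\preceq B$ (resp. $A\prec B$) means $B-A$ is positive semidefinite (resp. positive definite); $\Sigma\succ0$ means $\Sigma$ is symmetric positive definite. $\nabla^2$ is the Hessian. A positive function $f$ is log-concave (resp. strictly log-concave) if $\log f$ is concave (resp. strictly concave) on $\mathbb{R}^d$. A mode of a density is a local maximizer of it. *)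

(* Defs.v *)
From HB Require Import structures.
From mathcomp Require Import all_boot all_order all_algebra.
From mathcomp Require Import all_classical all_reals all_analysis.
Set Implicit Arguments.
Unset Strict Implicit.
Unset Printing Implicit Defensive.
Import Order.TTheory GRing.Theory Num.Theory.
Import numFieldNormedType.Exports.
Local Open Scope classical_set_scope.
Local Open Scope convex_scope.
Local Open Scope ring_scope.

Section matrices.
Context {R : realType} {d : nat}.
Implicit Types (A B : 'M[R]_d) (v : 'cV[R]_d).

Definition qform A v : R := (v^T *m A *m v) 0 0.

(* The squared Euclidean norm; the library's norm on matrices is the sup norm. *)
Definition sqnorm v : R := (v^T *m v) 0 0.

Definition psdmx A : Prop := A^T = A /\ forall v, 0 <= qform A v.

Definition pdmx A : Prop := A^T = A /\ forall v, v != 0 -> 0 < qform A v.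

Definition loewner_le A B : Prop := psdmx (B - A).

Definition loewner_lt A B : Prop := pdmx (B - A).

(* The positive semidefinite square root, which exists and is unique for a
   positive semidefinite A; if there is none, the value is 0. *)
Definition sqrtmx A : 'M[R]_d := xget 0 [set B | psdmx B /\ B *m B = A].

End matrices.

Section functions.
Context {R : realType} {d : nat}.
Implicit Types f g : 'cV[R]_d -> R.

Definition partial (i : 'I_d) g : 'cV[R]_d -> R := 'D_(delta_mx i 0) g.

(* 'D is a total operator with a default value where the limit does not exist,
   so that an equation on hessian is to be read along with twice_diff. *)
Definition hessian g (x : 'cV[R]_d) : 'M[R]_d :=
  \matrix_(i, j) partial i (partial j g) x.

Definition twice_diff g : Prop :=
  (forall x, differentiable g x) /\
  (forall (i : 'I_d) x, differentiable (partial i g) x).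

Definition concave g : Prop := convex_function setT (fun x => - g x).

Definition strictly_concave g : Prop :=
  forall (t : {i01 R}) (x y : convex_lmodType 'cV[R]_d),
    0 < t%:num < 1 -> x != y ->
    (g x : R^o) <| t |> (g y : R^o) < g (x <| t |> y).

(* Positivity is part of the notion, as ln is 0 on nonpositive reals. *)
Definition log_concave f : Prop :=
  (forall x, 0 < f x) /\ concave (fun x => ln (f x)).

Definition strictly_log_concave f : Prop :=
  (forall x, 0 < f x) /\ strictly_concave (fun x => ln (f x)).

Definition is_mode f (m : 'cV[R]_d) : Prop := \forall x \near m, f x <= f m.

Definition superlevel f (l : R) : set (convex_lmodType 'cV[R]_d) :=
  [set x | l <= f x].

End functions.

Section densities.
Context {R : realType} {d n : nat}.
Implicit Types (Sigma : 'M[R]_d) (p : 'I_n -> R) (mu X : 'I_n -> 'cV[R]_d).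
Implicit Types x : 'cV[R]_d.

Definition gauss_pdf Sigma x : R :=
  (Num.sqrt ((2 * pi) ^+ d * \det Sigma))^-1 *
  expR (- (qform (invmx Sigma) x / 2)).

Definition gauss_mix Sigma p mu x : R :=
  \sum_(i < n) p i * gauss_pdf Sigma (x - mu i).

Definition post_weight Sigma p mu (i : 'I_n) x : R :=
  p i * gauss_pdf Sigma (x - mu i) / gauss_mix Sigma p mu x.

Definition post_mean Sigma p mu x : 'cV[R]_d :=
  \sum_(i < n) post_weight Sigma p mu i x *: mu i.

Definition post_cov Sigma p mu x : 'M[R]_d :=
  \sum_(i < n) post_weight Sigma p mu i x *:
    ((mu i - post_mean Sigma p mu x) *m (mu i - post_mean Sigma p mu x)^T).

(* For n > 0 this is the maximum of the family, as it is only applied to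
   nonnegative families. *)
Definition nneg_max (F : 'I_n -> R) : R := \big[Num.max/0]_(i < n) F i.

Definition heat_kde X (t : R) x : R :=
  n%:R^-1 * \sum_(i < n) gauss_pdf t%:M (x - X i).

Definition sample_mean X : 'cV[R]_d := n%:R^-1 *: \sum_(i < n) X i.

Definition sample_cov X : 'M[R]_d :=
  n%:R^-1 *: \sum_(i < n) (X i - sample_mean X) *m (X i - sample_mean X)^T.

Definition ou_path X (t : R) x : R :=
  n%:R^-1 * \sum_(i < n)
    gauss_pdf ((1 - expR (- (2 * t))) *: sample_cov X)
      (x - sample_mean X - expR (- t) *: (X i - sample_mean X)).

Definition mahalanobis_radius2 X : R :=
  nneg_max (fun i => qform (invmx (sample_cov X)) (X i - sample_mean X)).

End densities.

(* Main.v *)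
Require Import Defs.
From HB Require Import structures.
From mathcomp Require Import all_boot all_order all_algebra.
From mathcomp Require Import all_classical all_reals all_analysis.
From mathcomp Require Import ring lra.
From mathcomp Require Import complex.
Import Order.TTheory GRing.Theory Num.Theory.
Import numFieldNormedType.Exports.
Local Open Scope classical_set_scope.
Local Open Scope ring_scope.

Set Implicit Arguments.
Unset Strict Implicit.
Unset Printing Implicit Defensive.

(* With A = Sigma^-1, the score is D_v ln f (x) = (A v)^T (m(x) - x), m being
   the posterior mean, and differentiating the weights once more turns the
   Hessian into -A + A C A = -A (Sigma - C) A. Along a segment of direction v
   the concavity gap of ln f is thus a positive multiple of the form of
   Sigma - C at A v. If all means lie within Mahalanobis distance 1 of c,
   Cauchy-Schwarz bounds the posterior variance of v^T mu_i about c, and hence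
   v^T C v, strictly by v^T Sigma v. Both paths in the theorem are Gaussian
   mixtures of this kind. A mode exists because the superlevel sets are compact,
   and is unique because strict log-concavity makes any local maximizer a
   strict global one.
   The statement needs the existence of matrix square roots, both for the factor
   Sigma^-1/2 and for the positivity of det Sigma. They are obtained as
   polynomials in the matrix, interpolating the square root on the spectrum. *)

(** * Inner product and positive definite matrices *)

Section dotp.
Context {R : realType} {d : nat}.
Implicit Types (A : 'M[R]_d) (u v x : 'cV[R]_d).

Definition dotp u v : R := (u^T *m v) 0 0.

Lemma dotpE u v : dotp u v = \sum_i u i 0 * v i 0.
Proof. by rewrite /dotp mxE; apply: eq_bigr => i _; rewrite mxE. Qed.

Lemma dotp_is_linear u : linear (dotp u : _ -> R^o).
Proof. by move=> a v w; rewrite /dotp mulmxDr -scalemxAr !mxE. Qed.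

HB.instance Definition _ u :=
  GRing.isLinear.Build R 'cV[R]_d R^o *:%R (dotp u) (dotp_is_linear u).

Lemma dotpC u v : dotp u v = dotp v u.
Proof. by rewrite !dotpE; apply: eq_bigr => i _; rewrite mulrC. Qed.

Lemma dotpDr u v w : dotp u (v + w) = dotp u v + dotp u w.
Proof. exact: (raddfD (dotp u)). Qed.

Lemma dotpNr u v : dotp u (- v) = - dotp u v.
Proof. exact: (raddfN (dotp u)). Qed.

Lemma dotpBr u v w : dotp u (v - w) = dotp u v - dotp u w.
Proof. exact: (raddfB (dotp u)). Qed.

Lemma dotpZr u a v : dotp u (a *: v) = a * dotp u v.
Proof. by rewrite /dotp -scalemxAr mxE. Qed.

Lemma dotp_sumr I (r : seq I) u (F : I -> 'cV[R]_d) :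
  dotp u (\sum_(i <- r) F i) = \sum_(i <- r) dotp u (F i).
Proof. exact: (raddf_sum (dotp u)). Qed.

Lemma dotpBl u v w : dotp (v - w) u = dotp v u - dotp w u.
Proof. by rewrite !(dotpC _ u) dotpBr. Qed.

Lemma dotpZl u a v : dotp (a *: v) u = a * dotp v u.
Proof. by rewrite !(dotpC _ u) dotpZr. Qed.

Lemma dotp_mulmxl A u v : dotp (A *m u) v = dotp u (A^T *m v).
Proof. by rewrite /dotp trmx_mul mulmxA. Qed.

Lemma dotp_delta A i j : dotp (delta_mx i 0) (A *m delta_mx j 0) = A i j.
Proof. by rewrite /dotp trmx_delta -rowE -colE !mxE. Qed.

Lemma dotp_rank1 u v w : dotp v ((u *m u^T) *m w) = dotp v u * dotp u w.
Proof. by rewrite /dotp !mulmxA -mulmxA mxE big_ord1. Qed.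

Lemma qformE A v : qform A v = dotp v (A *m v).
Proof. by rewrite /qform /dotp mulmxA. Qed.

Lemma sqnormE v : sqnorm v = dotp v v.
Proof. by []. Qed.

Lemma pdmx_qform_ge0 A v : pdmx A -> 0 <= qform A v.
Proof.
move=> [_ A0]; have [->|/A0/ltW//] := eqVneq v 0.
by rewrite /qform mulmx0 mxE.
Qed.

Lemma pdmx_unit A : pdmx A -> A \in unitmx.
Proof.
move=> [AT A0]; rewrite -row_free_unit; apply/row_freeP.
case: (boolP (row_free A)) => [/row_freeP//|].
rewrite -kermx_eq0 => /rowV0Pn[v /sub_kermxP vA v0]; exfalso.
have := A0 v^T; rewrite trmx_eq0 v0 => /(_ isT).
by rewrite /qform trmxK vA mul0mx mxE ltxx.
Qed.

(** The form of [invmx A] at [v] is the form of [A] at [invmx A *m v]. *)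
Lemma pdmx_inv A : pdmx A -> pdmx (invmx A).
Proof.
move=> pA; have uA := pdmx_unit pA; have [AT A0] := pA.
have iT : (invmx A)^T = invmx A by rewrite trmx_inv AT.
split=> // v v0; have : invmx A *m v != 0.
  by apply: contra_neq v0 => e; rewrite -(mulKVmx uA v) e mulmx0.
by move/A0; rewrite !qformE mulKVmx // dotp_mulmxl iT.
Qed.

Lemma pdmxZ A a : 0 < a -> pdmx A -> pdmx (a *: A).
Proof.
move=> a0 [AT A0]; split; first by rewrite linearZ /= AT.
by move=> v /A0; rewrite !qformE -scalemxAl dotpZr => ?; rewrite mulr_gt0.
Qed.

Lemma invmxZr A a : a != 0 -> A \in unitmx -> invmx (a *: A) = a^-1 *: invmx A.
Proof. by move=> a0 uA; rewrite invmxZ// unitmxZ// unitfE. Qed.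

Lemma pdmx1 : pdmx (1%:M : 'M[R]_d).
Proof.
split; first by rewrite trmx1.
move=> v v0; rewrite qformE mul1mx dotpE; rewrite lt_neqAle eq_sym.
rewrite sumr_ge0 ?andbT; last by move=> i _; rewrite -expr2 sqr_ge0.
apply: contra_neq v0 => /psumr_eq0P e; apply/colP => i; rewrite mxE.
by apply/eqP; rewrite -sqrf_eq0 expr2 e// => j _; rewrite -expr2 sqr_ge0.
Qed.

(* Cauchy-Schwarz for the inner product of [A]: since [u = A (A^-1 u)], the
   form of [A] at [v - s A^-1 u] is a nonnegative quadratic polynomial in [s]. *)
Lemma dotp_le_qform A u v : pdmx A ->
  dotp u v ^+ 2 <= qform A v * qform (invmx A) u.
Proof.
move=> pA; have uA := pdmx_unit pA; have piA := pdmx_inv pA.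
have [AT A0] := pA; have [iAT iA0] := piA.
have [->|/iA0 q0] := eqVneq u 0.
  by rewrite dotpC (raddf0 (dotp v)) expr0n mulr_ge0 ?pdmx_qform_ge0.
set s := dotp u v / qform (invmx A) u.
have := pdmx_qform_ge0 (v - s *: (invmx A *m u)) pA.
have e : dotp (invmx A *m u) (A *m v) = dotp u v.
  by rewrite dotp_mulmxl iAT mulKmx.
rewrite qformE mulmxBr -scalemxAr mulKVmx // dotpBr !dotpBl !dotpZl !dotpZr e.
rewrite (dotpC v u) (dotpC _ u) -!qformE /s.
move=> h; rewrite -ler_pdivrMr // -subr_ge0; apply: le_trans h _.
by rewrite le_eqVlt; apply/orP; left; apply/eqP; field; rewrite gt_eqF.
Qed.

End dotp.

(** * Square roots of positive definite matrices *)

Section sqrtmx.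
Context {R : realType}.

(** Newton interpolation: a new point is matched by adding a multiple of the product of ['X - y%:P]
    over the earlier points, which leaves the earlier values alone. *)
Lemma poly_interpolation (F : fieldType) (g : F -> F) (s : seq F) :
  exists r : {poly F}, forall x, x \in s -> r.[x] = g x.
Proof.
elim: s => [|a s [r rE]]; first by exists 0.
have [sa|sa] := boolP (a \in s).
  by exists r => x; rewrite inE => /predU1P[->|]; exact: rE.
pose q := \prod_(y <- s) ('X - y%:P).
have qa : q.[a] != 0 by rewrite -[_ == _]/(root q a) root_prod_XsubC.
exists (r + ((g a - r.[a]) / q.[a])%:P * q) => x; rewrite inE !hornerE.
move=> /predU1P[->|xs]; first by rewrite divfK // addrC subrK.
suff /rootP -> : root q x by rewrite mulr0 addr0 rE.
by rewrite root_prod_XsubC.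
Qed.

Lemma trmx_horner_mx n (A : 'M[R]_n.+1) (r : {poly R}) :
  A^T = A -> (horner_mx A r)^T = horner_mx A r.
Proof.
move=> AT; elim/poly_ind: r => [|r c IH]; first by rewrite rmorph0 trmx0.
rewrite !(rmorphD, rmorphM) /= horner_mx_X horner_mx_C linearD /= tr_scalar_mx.
by rewrite trmx_mul IH AT; congr (_ + _); exact: comm_mx_horner.
Qed.

(** At an eigenvector the form equals the eigenvalue times the squared norm. *)
Lemma eigenvalue_pdmx_gt0 n (A : 'M[R]_n) a :
  pdmx A -> eigenvalue A a -> 0 < a.
Proof.
move=> [AT A0] /eigenvalueP[v vA v0].
have := A0 v^T; rewrite trmx_eq0 v0 => /(_ isT).
rewrite /qform trmxK vA -scalemxAl mxE.
have := (@pdmx1 R n).2 v^T; rewrite trmx_eq0 v0 => /(_ isT).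
by rewrite /qform trmxK mulmx1 => h; rewrite pmulr_lgt0.
Qed.

(* [A] is diagonalized over the complex numbers, but the vanishing of a real
   polynomial in [A] descends to the reals. *)
Lemma pdmx_horner_mx n (A : 'M[R]_n.+1) : pdmx A ->
  exists s : seq R, (forall l, l \in s -> 0 < l) /\
  forall r : {poly R}, (forall l, l \in s -> root r l) -> horner_mx A r = 0.
Proof.
move=> pA; have [AT _] := pA.
pose C : numClosedFieldType := complex R.
pose toC : {rmorphism R -> C} := real_complex R.
pose AC := map_mx toC A.
have AC_herm : AC \is hermitianmx _ false Num.conj.
  apply: realsym_hermsym.
    apply/is_hermitianmxP; rewrite expr0 scale1r map_mx_id //.
    by apply/matrixP => i j; rewrite !mxE -{1}AT mxE.
  apply/mxOverP => i j; rewrite mxE.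
  by rewrite complex_real.
have /orthomx_spectralP ACE := hermitian_normalmx AC_herm.
have /mxOverP spr := hermitian_spectral_diag_real AC_herm.
have Pu := spectral_unit AC.
set P := spectralmx AC in ACE Pu; set sp := spectral_diag AC in ACE spr.
pose lam i := complex.Re (sp 0 i).
(* The spectrum of a Hermitian matrix is real, so taking real parts loses nothing. *)
have lamE i : toC (lam i) = sp 0 i by rewrite [LHS]complex.RRe_real.
exists [seq lam i | i <- enum 'I_n.+1]; split.
  move=> _ /mapP[i _ ->]; apply: (eigenvalue_pdmx_gt0 pA).
  (* Being a root of the characteristic polynomial can be checked over the complex numbers, where
     row [i] of [P] is an eigenvector. *)
  rewrite eigenvalue_root_char -(fmorph_root toC) map_char_poly.
  rewrite -eigenvalue_root_char lamE; apply/eigenvalueP; exists (row i P).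
    rewrite -/AC ACE -row_mul !mulmxA mulmxV // mul1mx row_mul row_diag_mx.
    by rewrite -scalemxAl -rowE.
  apply/eqP => r0; have /rowP/(_ i) := row_mul i P (invmx P).
  by rewrite mulmxV // r0 mul0mx !mxE eqxx => /eqP; rewrite oner_eq0.
move=> r rs; apply: (@map_mx_inj _ _ toC); rewrite map_mx0 map_horner_mx -/AC.
rewrite ACE horner_mx_uconjC // horner_mx_diag.
have -> : map_mx (horner (map_poly toC r)) sp = 0.
  apply/rowP => i; rewrite mxE mxE -lamE horner_map.
  by rewrite (rootP (rs _ _)) ?rmorph0 // map_f ?mem_enum.
by rewrite raddf0 mulmx0 mul0mx.
Qed.

Lemma pdmx_sqrt_exists d (A : 'M[R]_d) : pdmx A ->
  exists B : 'M[R]_d, psdmx B /\ B *m B = A.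
Proof.
case: d A => [|n] A pA.
  (* The polynomial calculus takes place in matrices of positive size; in size 0 all matrices
     coincide. *)
  exists A; split; last by rewrite [RHS]flatmx0 [LHS]flatmx0.
  by split; [case: pA | move=> v; exact: pdmx_qform_ge0].
have [s [s0 sA]] := pdmx_horner_mx pA.
(* Fourth roots are interpolated, so that the square root of [A] is the square of a symmetric matrix
   [H] and its form at [v] is the squared norm of [H *m v]. *)
have [r rE] := poly_interpolation (fun l => Num.sqrt (Num.sqrt l)) s.
pose H := horner_mx A r; have [AT _] := pA.
have HT : H^T = H by exact: trmx_horner_mx.
have HHA : (H *m H) *m (H *m H) = A.
  apply/eqP; rewrite -subr_eq0; apply/eqP.
  rewrite -[RHS](sA ((r * r) * (r * r) - 'X)); last first.
    move=> l ls; have l0 := s0 _ ls; apply/rootP.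
    rewrite hornerD hornerN hornerX !hornerM rE //.
    have sqrtM (a : R) : 0 <= a -> Num.sqrt a * Num.sqrt a = a.
      by move=> a0; rewrite -expr2 sqr_sqrtr.
    by rewrite !sqrtM ?sqrtr_ge0 ?ltW // subrr.
  by rewrite rmorphB !rmorphM /= horner_mx_X.
exists (H *m H); split=> //; split; first by rewrite trmx_mul HT.
move=> v; rewrite qformE -mulmxA -{1}HT -dotp_mulmxl.
by rewrite dotpE sumr_ge0 // => i _; rewrite -expr2 sqr_ge0.
Qed.

Lemma sqrtmxP d (A : 'M[R]_d) : pdmx A ->
  psdmx (sqrtmx A) /\ sqrtmx A *m sqrtmx A = A.
Proof. by move=> /pdmx_sqrt_exists sA; apply: (xgetPex 0) sA. Qed.

Lemma sqnorm_sqrtmx d (A : 'M[R]_d) v : pdmx A ->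
  sqnorm (sqrtmx A *m v) = qform A v.
Proof.
move=> /sqrtmxP[[BT _] BB].
by rewrite sqnormE dotp_mulmxl BT mulmxA BB qformE.
Qed.

(** The determinant is nonzero and, thanks to the square root of [A], a square. *)
Lemma pdmx_det_gt0 d (A : 'M[R]_d) : pdmx A -> 0 < \det A.
Proof.
move=> pA; have := pdmx_unit pA; rewrite unitmxE unitfE lt_neqAle eq_sym => ->.
have [_ <-] := sqrtmxP pA.
by rewrite det_mulmx -expr2 sqr_ge0.
Qed.

End sqrtmx.

(** * Differentials, and the concavity gap in one variable *)

Section calculus.
Context {R : realType}.

Lemma is_diff_derive (V W : normedModType R) (f df : V -> W) x v :
  is_diff x f df -> 'D_v f x = df v.
Proof. by move=> dfx; rewrite deriveE ?diff_val. Qed.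

Lemma is_diff_differentiable (V W : normedModType R) (f df : V -> W) x :
  is_diff x f df -> differentiable f x.
Proof. by []. Qed.

Lemma is_diff_is_derive (V W : normedModType R) (f df : V -> W) x v :
  is_diff x f df -> is_derive x v f (df v).
Proof.
move=> dfx; rewrite -(is_diff_derive v dfx).
exact/derivableP/diff_derivable.
Qed.

Lemma is_diff_sum (V W : normedModType R) n (f df : 'I_n -> V -> W) x :
  (forall i, is_diff x (f i) (df i)) ->
  is_diff x (fun y => \sum_i f i y) (fun v => \sum_i df i v).
Proof.
elim: n f df => [|n IH] f df fdf.
  have -> : (fun y => \sum_(i < 0) f i y) = cst 0.
    by apply/funext => y; rewrite big_ord0.
  apply: (is_diff_eq (is_diff_cst _ _)).
  by apply/funext => v; rewrite big_ord0.
have -> : (fun y => \sum_i f i y) =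
    f ord0 + (fun y => \sum_i f (lift ord0 i) y).
  by apply/funext => y; rewrite big_ord_recl.
apply: (is_diff_eq (is_diffD (fdf _) (IH _ _ (fun i => fdf (lift ord0 i))))).
by apply/funext => v; rewrite big_ord_recl.
Qed.

Lemma is_diff_scalar_comp (V : normedModType R) (h : R -> R) (g dg : V -> R) x c :
  is_derive (g x) 1 h c -> is_diff x g dg ->
  is_diff x (h \o g) (fun v => c * dg v).
Proof.
move=> hc gdg; have dh : differentiable h (g x) by apply/derivable1_diffP.
apply: (is_diff_eq (is_diff_comp gdg (differentiableP dh))).
apply/funext => v /=; rewrite deriv1E // derive1E derive_val.
exact: mulrC.
Qed.

Lemma is_diff_linear (d : nat) (u x : 'cV[R]_d) :
  is_diff x (dotp u : 'cV[R]_d -> R) (dotp u).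
Proof.
have df y : differentiable (dotp u : 'cV[R]_d -> R) y.
  have -> : (dotp u : 'cV[R]_d -> R) =
      \sum_i (u i 0 *: (fun v : 'cV[R]_d => v i 0 : R)).
    by apply/funext => v; rewrite dotpE fct_sumE.
  by apply: differentiable_sum => i; apply/differentiableZ/differentiable_coord.
apply: DiffDef => //.
by apply: (diff_lin (f := dotp u)) => y; apply: differentiable_continuous.
Qed.

(** Both difference quotients are the same function of [h]. This reduces concavity on a segment to
    one real variable. *)
Lemma derive_along_line (V : normedModType R) (f : V -> R) (y v : V) (s : R) a :
  is_derive (y + s *: v) v f a -> is_derive s 1 (fun r : R => f (y + r *: v)) a.
Proof.
have e : (fun h : R => h^-1 *:
    (((fun r : R => f (y + r *: v)) \o shift s) (h *: (1 : R))
           - f (y + s *: v))) =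
   (fun h : R => h^-1 *: ((f \o shift (y + s *: v)) (h *: v) - f (y + s *: v))).
  apply/funext => h /=; congr (_ *: (f _ - _)).
  by rewrite scalerDl [h%:A]mulr1 addrCA.
move=> [df fa]; split; first by move: df; rewrite /derivable e.
by move: fa; rewrite /derive e.
Qed.

(* Mean value theorem for [h] on [0, t] and on [t, 1], then for [h'] between
   the two intermediate points. *)
Lemma convexity_gap (h dh ddh : R -> R) (t : R) : 0 < t < 1 ->
  (forall s : R, is_derive s (1 : R) h (dh s)) ->
  (forall s : R, is_derive s (1 : R) dh (ddh s)) ->
  exists z delta, 0 < delta /\
    h t - (t * h 1 + (1 - t) * h 0) = - (delta * ddh z).
Proof.
move=> /andP[t0 t1] hd dhd.
have ch (f df : R -> R) a b : (forall s : R, is_derive s (1 : R) f (df s)) ->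
    {within `[a, b], continuous f}.
  move=> fd; apply: derivable_within_continuous => s _; exact: ex_derive.
have [x1] := MVT t0 (fun s _ => hd s) (ch _ _ _ _ hd).
have [x2] := MVT t1 (fun s _ => hd s) (ch _ _ _ _ hd).
rewrite !in_itv /= => /andP[tx2 x21] e2 /andP[x10 x1t] e1.
have x12 := lt_trans x1t tx2.
have [z _ e3] := MVT x12 (fun s _ => dhd s) (ch _ _ _ _ dhd).
(* The gap is (1 - t)(h t - h 0) - t (h 1 - h t), hence t (1 - t)(dh x1 - dh x2) by the first two
   mean values. *)
exists z, (t * (1 - t) * (x2 - x1)); split.
  by rewrite !mulr_gt0 // subr_gt0.
have -> : - (t * (1 - t) * (x2 - x1) * ddh z) =
  - (t * (1 - t)) * (ddh z * (x2 - x1)) by ring.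
rewrite -e3; have -> : - (t * (1 - t)) * (dh x2 - dh x1) =
   (1 - t) * (dh x1 * (t - 0)) - t * (dh x2 * (1 - t)) by ring.
by rewrite -e1 -e2; ring.
Qed.

End calculus.

(** * Differential of a Gaussian density *)

Section gaussian.
Context {R : realType} {d : nat}.
Implicit Types (A Sigma : 'M[R]_d) (m x v : 'cV[R]_d).

(** The form is the sum over [k] of products of the linear functionals [v k 0] and [(A *m v) k 0];
    the product rule gives two sums, equal by symmetry of [A]. *)
Lemma is_diff_qform A m x : A^T = A ->
  is_diff x (fun y => qform A (y - m)) (fun v => 2 * dotp (A *m (x - m)) v).
Proof.
move=> AT; pose e k : 'cV[R]_d := delta_mx k 0.
have eE k (v : 'cV[R]_d) : dotp (e k) v = v k 0.
  by rewrite /dotp trmx_delta -rowE mxE.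
have aE k (v : 'cV[R]_d) : dotp (row k A)^T v = (A *m v) k 0.
  by rewrite /dotp trmxK -row_mul mxE.
have qE : qform A = \sum_k (dotp (e k) : _ -> R) * (dotp (row k A)^T : _ -> R).
  apply/funext => v; rewrite qformE dotpE fct_sumE; apply: eq_bigr => k _.
  by rewrite fctE eE aE.
have lin (u z : 'cV[R]_d) := is_diff_linear u z.
have dq (z : 'cV[R]_d) : is_diff z (qform A) (fun v => 2 * dotp (A *m z) v).
  rewrite qE fct_sumE.
  apply: (is_diff_eq (is_diff_sum (fun k =>
    is_diffM (lin (e k) z) (lin (row k A)^T z)))).
  apply/funext => v; rewrite mulr2n mulrDl mul1r.
  rewrite {1}dotp_mulmxl AT !dotpE -big_split /=; apply: eq_bigr => k _.
  by rewrite -!aE -!eE.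
have ds : is_diff x (fun y : 'cV[R]_d => y - m) id.
  apply: (is_diff_eq (is_diffB (is_diff_id x) (is_diff_cst m x))).
  by rewrite subr0.
by apply: (is_diff_eq (is_diff_comp ds (dq (x - m)))).
Qed.

Lemma gauss_const_gt0 Sigma : pdmx Sigma ->
  0 < (Num.sqrt ((2 * pi) ^+ d * \det Sigma))^-1.
Proof.
move=> pS; rewrite invr_gt0 sqrtr_gt0 mulr_gt0 ?pdmx_det_gt0 //.
by rewrite exprn_gt0 // mulr_gt0 ?pi_gt0.
Qed.

Lemma gauss_pdf_gt0 Sigma x : pdmx Sigma -> 0 < gauss_pdf Sigma x.
Proof. by move=> pS; rewrite mulr_gt0 ?expR_gt0 ?gauss_const_gt0. Qed.

Lemma is_diff_gauss_pdf Sigma m x : pdmx Sigma ->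
  is_diff x (fun y => gauss_pdf Sigma (y - m))
    (fun v => gauss_pdf Sigma (x - m) * dotp (invmx Sigma *m (m - x)) v).
Proof.
move=> /pdmx_inv[AT _]; rewrite /gauss_pdf.
set K := (Num.sqrt _)^-1; set A := invmx Sigma in AT *.
pose h (r : R) := K * expR (- (r / 2)).
have dh r : is_derive r (1 : R) h (K * (expR (- (r / 2)) * - 2^-1)).
  have d1 : is_derive r (1 : R) (fun s : R => - (s / 2)) (- 2^-1).
    have -> : (fun s : R => - (s / 2)) = - (2^-1 *: id).
      by apply/funext => s; rewrite !fctE /= mulrC.
    by apply: is_derive_eq; rewrite [_ *: _]mulr1.
  have d2 := @is_derive1_comp _ expR (fun s => - (s / 2)) r _ _
    (is_derive_expR _) d1.
  by apply: (is_derive_eq (is_deriveZ K d2)).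
apply: (is_diff_eq (is_diff_scalar_comp (dh _) (is_diff_qform m x AT))).
apply/funext => v; rewrite -(opprB x m) mulmxN [in RHS]dotpC dotpNr [in RHS]dotpC.
by field.
Qed.

End gaussian.

(** * Differentials of a mixture, its posterior weights and its score *)

Section mixture.
Context {R : realType} {d n : nat}.
Variables (Sigma : 'M[R]_d) (p : 'I_n -> R) (mu : 'I_n -> 'cV[R]_d).
Hypotheses (n_gt0 : (0 < n)%N) (pS : pdmx Sigma) (p_gt0 : forall i, 0 < p i).

Local Notation f := (gauss_mix Sigma p mu).
Local Notation w := (post_weight Sigma p mu).
Local Notation mbar := (post_mean Sigma p mu).
Local Notation C := (post_cov Sigma p mu).
Local Notation A := (invmx Sigma).
Local Notation g i := (fun y => p i * gauss_pdf Sigma (y - mu i)).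

Let AT : A^T = A. Proof. by case: (pdmx_inv pS). Qed.

Let g_gt0 i x : 0 < g i x.
Proof. by rewrite mulr_gt0 ?gauss_pdf_gt0. Qed.

Lemma gauss_mix_gt0 x : 0 < f x.
Proof.
rewrite /gauss_mix lt_neqAle eq_sym; apply/andP; split; last first.
  by rewrite sumr_ge0 // => i _; apply/ltW/g_gt0.
apply/negP => /eqP /psumr_eq0P h; have := g_gt0 (Ordinal n_gt0) x.
by rewrite h ?ltxx // => i _; apply/ltW/g_gt0.
Qed.

Lemma post_weight_gt0 i x : 0 < w i x.
Proof. by rewrite divr_gt0 ?g_gt0 ?gauss_mix_gt0. Qed.

Lemma post_weight_sum x : \sum_i w i x = 1.
Proof. by rewrite -mulr_suml divff // gt_eqF ?gauss_mix_gt0. Qed.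

Lemma dotp_post_mean b x : dotp b (mbar x) = \sum_i w i x * dotp b (mu i).
Proof. by rewrite dotp_sumr; apply: eq_bigr => i _; rewrite dotpZr. Qed.

(** The weights sum to 1, so [c] passes inside. With [c = x] this gives the score of the mixture;
    with [c] the posterior mean it says that deviations average to zero. *)
Lemma dotp_post_meanB b c x :
  dotp b (mbar x - c) = \sum_i w i x * dotp b (mu i - c).
Proof.
rewrite dotpBr dotp_post_mean.
under [RHS]eq_bigr do rewrite dotpBr mulrBr.
by rewrite sumrB -mulr_suml post_weight_sum mul1r.
Qed.

Lemma trmx_post_cov x : (C x)^T = C x.
Proof.
rewrite [LHS]raddf_sum; apply: eq_bigr => i _.
by rewrite -[LHS]/(trmx _) linearZ /= trmx_mul trmxK.
Qed.

Lemma dotp_post_cov b v x : dotp b (C x *m v) =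
  \sum_i w i x * (dotp b (mu i - mbar x) * dotp (mu i - mbar x) v).
Proof.
rewrite /post_cov mulmx_suml dotp_sumr; apply: eq_bigr => i _.
by rewrite -scalemxAl dotpZr dotp_rank1.
Qed.

Let is_diff_g i x : is_diff x (g i) (fun v => g i x * dotp (A *m (mu i - x)) v).
Proof.
apply: (is_diff_eq (is_diffZ (p i) (is_diff_gauss_pdf (mu i) x pS))).
by apply/funext => v; rewrite fctE [LHS]mulrA.
Qed.

(** Each term of the mixture is [f x] times its weight, so the differentials of the components
    recombine into the posterior mean. *)
Lemma is_diff_gauss_mix x :
  is_diff x f (fun v => f x * dotp (A *m (mbar x - x)) v).
Proof.
apply: (is_diff_eq (is_diff_sum (fun i => is_diff_g i x))).
apply/funext => v; rewrite dotp_mulmxl AT dotpC dotp_post_meanB mulr_sumr.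
apply: eq_bigr => i _; rewrite dotp_mulmxl AT dotpC mulrA; congr (_ * _).
by rewrite /post_weight [RHS]mulrC divfK // gt_eqF ?gauss_mix_gt0.
Qed.

Lemma is_diff_ln_gauss_mix x :
  is_diff x (fun y => ln (f y)) (fun v => dotp (A *m v) (mbar x - x)).
Proof.
apply: (is_diff_eq (is_diff_scalar_comp (is_derive1_ln (gauss_mix_gt0 x))
  (is_diff_gauss_mix x))).
apply/funext => v; rewrite mulKf ?gt_eqF ?gauss_mix_gt0 //.
by rewrite dotpC (dotp_mulmxl A v) AT.
Qed.

(** The logarithmic derivative of a weight is the score of its component minus that of the mixture,
    in which [x] cancels. *)
Lemma is_diff_post_weight i x :
  is_diff x (w i) (fun v => w i x * dotp (A *m v) (mu i - mbar x)).
Proof.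
have f0 : f x != 0 by rewrite gt_eqF ?gauss_mix_gt0.
have dV : is_derive (f x) (1 : R) (fun r : R => r^-1) (- (f x) ^- 2).
  have := @is_deriveV _ id (f x) 1 1 f0 _.
  by rewrite [_ *: _]mulr1; apply.
apply: (is_diff_eq (is_diffM (is_diff_g i x)
  (is_diff_scalar_comp dV (is_diff_gauss_mix x)))).
apply/funext => v; rewrite /post_weight !fctE /=.
have AE z : dotp (A *m z) v = dotp (A *m v) z by rewrite dotp_mulmxl AT dotpC.
have -> : mu i - mbar x = (mu i - x) - (mbar x - x).
  by rewrite opprB addrA subrK.
rewrite dotpBr !AE.
rewrite /GRing.scale /=.
by field.
Qed.

Lemma is_diff_score b x : is_diff x (fun y => dotp b (mbar y - y))
  (fun v => dotp b (C x *m (A *m v)) - dotp b v).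
Proof.
have -> : (fun y => dotp b (mbar y - y)) =
    (fun y => \sum_i (dotp b (mu i) *: w i) y) - dotp b.
  apply/funext => y; rewrite dotpBr dotp_post_mean; congr (_ - _).
  by apply: eq_bigr => i _; rewrite fctE mulrC.
apply: (is_diff_eq (is_diffB (is_diff_sum (fun i =>
  is_diffZ (dotp b (mu i)) (is_diff_post_weight i x))) (is_diff_linear b x))).
apply/funext => v; rewrite !fctE dotp_post_cov; congr (_ - _).
(* Replacing [mu i] by its deviation from the posterior mean changes the sum by a multiple of the
   weighted sum of deviations, which is zero. *)
apply/eqP; rewrite -subr_eq0 -sumrB.
have := dotp_post_meanB (A *m v) (mbar x) x.
rewrite subrr (raddf0 (dotp _)) => /esym/(congr1 (fun r => dotp b (mbar x) * r)).
rewrite mulr0 mulr_sumr => {2}<-; apply/eqP; apply: eq_bigr => i _.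
rewrite fctE (dotpC (mu i - _)) dotpBr /GRing.scale /=.
by ring.
Qed.

End mixture.

(** * Modes and superlevel sets of strictly log-concave functions *)

Section modes.
Context {R : realType} {d : nat}.
Implicit Types (h : 'cV[R]_d -> R) (x y m : 'cV[R]_d).

Lemma strictly_log_concaveP h : strictly_log_concave h ->
  (forall x, 0 < h x) /\
  (forall (t : R) x y, 0 < t < 1 -> x != y ->
     t * ln (h x) + (1 - t) * ln (h y) < ln (h (t *: x + (1 - t) *: y))).
Proof.
move=> [h0 hc]; split=> // t x y /andP[t0 t1] xy.
by have := hc (Itv01 (ltW t0) (ltW t1)) x y; apply => //=; rewrite t0.
Qed.

(** The weighted mean of the two logarithms is at least the smaller one. *)
Lemma strictly_log_concave_min h x y t : strictly_log_concave h ->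
  0 < t < 1 -> x != y -> h y <= h x -> h y < h (t *: x + (1 - t) *: y).
Proof.
move=> /strictly_log_concaveP[h0 hc] t01 xy yx.
have /andP[t0 t1] := t01.
rewrite -ltr_ln ?posrE //; apply: le_lt_trans (hc _ _ _ t01 xy).
have : ln (h y) <= ln (h x) by rewrite ler_ln ?posrE.
by nra.
Qed.

Lemma convex_superlevel h l :
  strictly_log_concave h -> convex_set (superlevel h l).
Proof.
move=> hc; apply/convex_setW => x y; rewrite !inE /superlevel /= => lx ly t t0 t1.
have [->|xy] := eqVneq x y; first by rewrite convmm inE.
rewrite inE /=; have t01 : 0 < t%:num < 1 by rewrite t0.
have [yx|/ltW xyh] := lerP (h y) (h x).
  exact/(le_trans ly)/ltW/strictly_log_concave_min.
(* The endpoints are exchanged so that the smaller value comes second. *)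
apply/(le_trans lx)/ltW; rewrite convC.
apply: strictly_log_concave_min => //=; last by rewrite eq_sym.
by rewrite subr_gt0 t1 ltrBlDr ltrDl.
Qed.

(** If [h y] were at least [h m], then [h] would exceed [h m] at all interior points of the segment
    from [m] to [y], even those near [m]. *)
Lemma is_mode_max h m y :
  strictly_log_concave h -> is_mode h m -> y != m -> h y < h m.
Proof.
move=> hc mm ym; rewrite ltNge; apply/negP => my.
have cvg0 : (fun t : R => t *: y + (1 - t) *: m) @ 0^'+ --> m.
  have -> : (fun t : R => t *: y + (1 - t) *: m) = (fun t => m + t *: (y - m)).
    apply/funext => t; rewrite scalerBl scale1r scalerBr addrCA.
    by congr (_ + _); rewrite addrC.
  have : (fun t : R => m + t *: (y - m)) @ 0^'+ --> m + 0 *: (y - m).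
    apply: cvgD; first exact: cvg_cst.
    by apply: cvgZr_tmp; exact: cvg_at_right_filter.
  by rewrite scale0r addr0.
have [t [[ht t0] t1]] : exists t : R,
    (h (t *: y + (1 - t) *: m) <= h m /\ 0 < t) /\ t < 1.
  near (0 : R)^'+ => t; exists t; split; last by near: t; exact: nbhs_right_lt.
  by split; near: t; [exact: (cvg0 _ mm) | exact: nbhs_right_gt].
have := strictly_log_concave_min hc _ ym my; move=> /(_ t).
by rewrite t0 t1 => /(_ isT); rewrite ltNge ht.
Unshelve. all: by end_near. Qed.

Lemma strictly_log_concave_unique_mode h m :
  strictly_log_concave h -> (forall x, h x <= h m) -> exists! x, is_mode h x.
Proof.
move=> hc hm; exists m; split; first by rewrite /is_mode; near=> x; exact: hm.
move=> x xm; apply/eqP; apply: contraT => mx.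
by have := is_mode_max hc xm mx; rewrite ltNge hm.
Unshelve. all: by end_near. Qed.

Lemma trmx_continuous p q : continuous (@trmx R p q).
Proof.
move=> x A /nbhs_ballP[e e0 xA]; apply/nbhs_ballP; exists e => // y [_ xy].
by apply: xA; split=> // i j; rewrite !mxE.
Qed.

(** The superlevel set at [h 0] is compact and nonempty, and a maximum over it is global.
    Transposition passes to row vectors, where the extreme value theorem is applied. *)
Lemma exists_max_superlevel h (B : R) : continuous h ->
  (forall x, h 0 <= h x -> forall k, `|x k 0| <= B) ->
  exists m, forall x, h x <= h m.
Proof.
move=> ch hB; pose K : set 'rV[R]_d := [set r | h 0 <= h r^T].
have cK : continuous (fun r : 'rV[R]_d => h r^T).
  by move=> r; apply: continuous_comp; [exact: trmx_continuous | exact: ch].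
have K0 : K 0 by rewrite /K /= trmx0.
have [||| m Km mK] := @EVT_max_rV R d (fun r => h r^T) K.
- by exists 0.
- apply: bounded_closed_compact; last first.
    exact: (closed_comp (fun r _ => cK r) (@closed_ge R (h 0))).
  (* The sup norm is a maximum starting from 0, so the bound must be nonnegative. *)
  exists (Num.max 0 B); split; first exact: num_real.
  move=> M BM r Kr; apply: le_trans (ltW BM).
  rewrite [leLHS]/Num.norm /= mx_normrE; apply: bigmax_le => [|[i j] _].
    by rewrite le_max lexx.
  by rewrite le_max ord1 /=; have := hB _ Kr j; rewrite mxE => ->; rewrite orbT.
- exact: continuous_subspaceT.
exists m^T => x; have [x0|/ltW x0] := lerP (h 0) (h x).
  by have := mK x^T; rewrite trmxK; apply; rewrite inE /K /= trmxK.
by apply: (le_trans x0); have := mK 0; rewrite trmx0; apply; rewrite inE.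
Qed.

End modes.

(** * Hessian, log-concavity and maximum of a Gaussian mixture *)

Section log_concavity.
Context {R : realType} {d n : nat}.
Variables (Sigma : 'M[R]_d) (p : 'I_n -> R) (mu : 'I_n -> 'cV[R]_d).
Hypotheses (n_gt0 : (0 < n)%N) (pS : pdmx Sigma) (p_gt0 : forall i, 0 < p i).

Local Notation f := (gauss_mix Sigma p mu).
Local Notation w := (post_weight Sigma p mu).
Local Notation mbar := (post_mean Sigma p mu).
Local Notation C := (post_cov Sigma p mu).
Local Notation A := (invmx Sigma).

Let AT : A^T = A. Proof. by case: (pdmx_inv pS). Qed.

Let score v x := dotp (A *m v) (mbar x - x).

Let is_diff_f x := is_diff_ln_gauss_mix mu n_gt0 pS p_gt0 x.
Let is_diff_s v x := is_diff_score mu n_gt0 pS p_gt0 (A *m v) x.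

Let derive_ln_mix v : 'D_v (fun y => ln (f y)) = score v.
Proof. by apply/funext => x; rewrite (is_diff_derive v (is_diff_f x)). Qed.

Lemma twice_diff_ln_gauss_mix : twice_diff (fun y => ln (f y)).
Proof.
split=> [x|i x]; first exact: is_diff_differentiable (is_diff_f x).
by rewrite /partial derive_ln_mix; exact: is_diff_differentiable (is_diff_s _ x).
Qed.

(** Differentiating the score of direction [j] in direction [i] gives entry (j, i) of the right-hand
    side, which is symmetric because [A] and [C x] are. *)
Lemma hessian_ln_gauss_mix x :
  hessian (fun y => ln (f y)) x = - A + A *m C x *m A.
Proof.
apply/matrixP => i j; rewrite mxE /partial derive_ln_mix.
rewrite (is_diff_derive _ (is_diff_s _ x)) -[RHS]dotp_delta.
rewrite mulmxDl mulNmx dotpDr dotpNr [RHS]addrC; congr (_ - _); last exact: dotpC.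
by rewrite [LHS]dotpC !dotp_mulmxl (trmx_post_cov Sigma p mu) AT !mulmxA.
Qed.

(** On the line from [y] in direction v = x - y, the second derivative of [ln f] is minus the form
    of [Sigma - C z] at [A *m v], as seen by writing v as [Sigma *m (A *m v)]. *)
Lemma ln_gauss_mix_gap (t : R) x y : 0 < t < 1 -> exists z delta, 0 < delta /\
  ln (f (t *: x + (1 - t) *: y)) - (t * ln (f x) + (1 - t) * ln (f y)) =
  delta * qform (Sigma - C z) (A *m (x - y)).
Proof.
move=> t01; set v := x - y.
have d1 s := derive_along_line (is_diff_is_derive v (is_diff_f (y + s *: v))).
have d2 s := derive_along_line (is_diff_is_derive v (is_diff_s v (y + s *: v))).
have [z [delta [d0 e]]] := convexity_gap t01 d1 d2.
exists (y + z *: v), delta; split=> //.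
have yv : y + v = x by rewrite addrC subrK.
move: e; rewrite scale0r addr0 scale1r yv.
have -> : y + t *: v = t *: x + (1 - t) *: y.
  by rewrite /v scalerBr scalerBl scale1r addrCA.
move=> ->; clearbody v.
by rewrite -mulrN opprB qformE mulmxBl dotpBr mulKVmx ?pdmx_unit.
Qed.

Lemma gauss_mix_log_concave :
  (forall x, loewner_le (C x) Sigma) -> log_concave f.
Proof.
move=> CS; split=> [x|]; first exact: gauss_mix_gt0.
(* The gap formula requires 0 < t < 1; at the endpoints concavity is an equality. *)
move=> t x y _ _; have [->|t0] := eqVneq t 0%:i01; first by rewrite !conv0.
have [->|t1] := eqVneq t 1%:i01; first by rewrite !conv1.
have t01 : 0 < t%:num < 1.
  by rewrite !lt_neqAle eq_sym t0 t1 ge0 le1.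
have [z [delta [d0 e]]] := ln_gauss_mix_gap x y t01.
rewrite -convN lerN2 -subr_ge0 [leRHS]e mulr_ge0 ?(ltW d0) //.
exact: (CS z).2.
Qed.

Lemma gauss_mix_strictly_log_concave :
  (forall x, loewner_lt (C x) Sigma) -> strictly_log_concave f.
Proof.
move=> CS; split=> [x|]; first exact: gauss_mix_gt0.
move=> t x y t01 xy; have [z [delta [d0 e]]] := ln_gauss_mix_gap x y t01.
rewrite -subr_gt0 [ltRHS]e mulr_gt0 //; apply: (CS z).2.
rewrite -subr_eq0 in xy; apply: contra_neq xy => e0.
by rewrite -[LHS](mulKVmx (pdmx_unit pS)) e0 mulmx0.
Qed.

Lemma post_cov_lt c : (forall i, qform A (mu i - c) < 1) ->
  forall x, loewner_lt (C x) Sigma.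
Proof.
move=> muc x; split.
  rewrite linearB /= (proj1 pS); congr (_ - _).
  exact: trmx_post_cov.
move=> v v0; rewrite qformE mulmxBl dotpBr subr_gt0.
pose D := \sum_i w i x * dotp v (mu i - c) ^+ 2.
have w1 := post_weight_sum mu n_gt0 pS p_gt0 x.
have wp i := post_weight_gt0 mu n_gt0 pS p_gt0 i x.
(* The weighted variance of the numbers [v^T mu_i] is at most their weighted
   second moment around any other centre. *)
have CD : dotp v (C x *m v) <= D.
  have -> : D = dotp v (C x *m v) + dotp v (mbar x - c) ^+ 2.
    have vs := dotp_post_meanB mu n_gt0 pS p_gt0 v (mbar x) x.
    rewrite subrr (raddf0 (dotp v)) in vs.
    set b := dotp v (mbar x - c).
    (* A vanishing cross term and the total weight 1 are inserted, so that the identity can be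
       checked term by term. *)
    have -> : dotp v (C x *m v) + b ^+ 2 = dotp v (C x *m v) +
        (2 * b * (\sum_i w i x * dotp v (mu i - mbar x)) + b ^+ 2 * \sum_i w i x).
      by rewrite -vs w1; ring.
    rewrite dotp_post_cov !mulr_sumr -!big_split /=; apply: eq_bigr => i _.
    have -> : mu i - c = (mu i - mbar x) + (mbar x - c) by rewrite addrA subrK.
    by rewrite dotpDr (dotpC (_ - _) v) -/b; ring.
  by rewrite lerDl sqr_ge0.
rewrite -(qformE Sigma); apply: (le_lt_trans CD).
(* Writing 1 as the sum of the weights reduces the bound to each term, where Cauchy-Schwarz applies;
   strictness of the sum needs at least one index. *)
rewrite -[ltRHS]mul1r -w1 mulr_suml.
have qv := (proj2 pS) v v0.
apply: ltr_sum => [|i _].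
  by apply/hasP; exists (Ordinal n_gt0); rewrite // mem_index_enum.
rewrite ltr_pM2l // dotpC; apply: le_lt_trans (dotp_le_qform _ _ pS) _.
by rewrite gtr_pMr.
Qed.

(* Some component is not small at [x], so [x] has bounded Mahalanobis distance to
   its mean, and by Cauchy-Schwarz this bounds each coordinate of [x]. *)
Lemma gauss_mix_superlevel_bounded :
  exists B, forall x, f 0 <= f x -> forall k, `|x k 0| <= B.
Proof.
pose P := \sum_i p i.
have f0 := gauss_mix_gt0 mu n_gt0 pS p_gt0 0.
pose K := (Num.sqrt ((2 * pi) ^+ d * \det Sigma))^-1.
have K0 : 0 < K by exact: gauss_const_gt0.
have P0 : 0 < P.
  rewrite /P (bigD1 (Ordinal n_gt0)) //= ltr_pwDl // sumr_ge0 // => i _.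
  exact: ltW.
(* A component of value at least [f 0 / P] has an exponential factor of at least [c]. *)
pose c := f 0 / P / K.
have c0 : 0 < c by rewrite !divr_gt0.
pose L := `|2 * ln c|.
(* The trace of [Sigma] dominates every diagonal entry, which makes the bound uniform in [k]. *)
pose M := \sum_k qform Sigma (delta_mx k 0).
(* A number whose square is at most [M * L] has absolute value at most [1 + M * L]. *)
exists (\sum_i `|mu i| + (1 + M * L)) => x fx k.
have [i hi] : exists i, f 0 / P <= gauss_pdf Sigma (x - mu i).
  apply/not_existsP => h; move: fx; rewrite leNgt => /negP; apply.
  have -> : f 0 = \sum_i p i * (f 0 / P).
    by rewrite -mulr_suml mulrC divfK // gt_eqF.
  apply: ltr_sum => [|i _].
  by apply/hasP; exists (Ordinal n_gt0); rewrite // mem_index_enum.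
  by rewrite ltr_pM2l // ltNge; apply/negP/h.
set q := qform A (x - mu i).
have qL : q <= L.
  have : c <= expR (- (q / 2)) by rewrite ler_pdivrMr // [leRHS]mulrC.
  rewrite -ler_ln ?posrE ?expR_gt0 // expRK => h.
  by rewrite /L -normrN; apply: le_trans (ler_norm _); lra.
have xk : (x k 0 - mu i k 0) ^+ 2 <= M * L.
  have eE : dotp (delta_mx k 0) (x - mu i) = x k 0 - mu i k 0.
    by rewrite /dotp trmx_delta -rowE !mxE.
  rewrite -eE dotpC; apply: le_trans (dotp_le_qform _ _ pS) _.
  rewrite ler_pM ?pdmx_qform_ge0 //; first exact: pdmx_inv.
  rewrite /M (bigD1 k) //= lerDl sumr_ge0 // => j _; exact: pdmx_qform_ge0.
have muk : `|mu i k 0| <= \sum_j `|mu j|.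
  apply: (@le_trans _ _ `|mu i|).
    rewrite [leRHS]/Num.norm /= mx_normrE.
    exact: (le_bigmax _ (fun ij : 'I_d * 'I_1 => `|mu i ij.1 ij.2|) (k, 0)).
  by rewrite (bigD1 i) //= lerDl sumr_ge0.
rewrite -(subrK (mu i k 0) (x k 0)) (le_trans (ler_normD _ _)) // addrC lerD //.
move: xk; set a := x k 0 - _; rewrite ler_norml => ?; apply/andP; split; nra.
Qed.

Lemma gauss_mix_max : exists m, forall x, f x <= f m.
Proof.
have [B fB] := gauss_mix_superlevel_bounded.
apply: exists_max_superlevel fB => x.
apply: differentiable_continuous.
exact: is_diff_differentiable (is_diff_gauss_mix mu n_gt0 pS p_gt0 x).
Qed.

End log_concavity.

(** * Unimodality for means within Mahalanobis distance 1 of a point, and the two paths *)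

Lemma gauss_mix_unimodal (R : realType) (d n : nat) (Sigma : 'M[R]_d)
    (p : 'I_n -> R) (mu : 'I_n -> 'cV[R]_d) c :
  (0 < n)%N -> pdmx Sigma -> (forall i, 0 < p i) ->
  (forall i, qform (invmx Sigma) (mu i - c) < 1) ->
  let f := gauss_mix Sigma p mu in
  [/\ strictly_log_concave f, exists! m, is_mode f m &
      forall l, 0 < l -> convex_set (superlevel f l)].
Proof.
move=> n_gt0 pS p_gt0 muc f.
have fc : strictly_log_concave f.
  by apply: gauss_mix_strictly_log_concave => //; exact: post_cov_lt muc.
split=> // [|l _]; last exact: convex_superlevel.
have [m fm] := gauss_mix_max mu n_gt0 pS p_gt0.
exact: strictly_log_concave_unique_mode fm.
Qed.

Lemma le_nneg_max (R : realType) (n : nat) (F : 'I_n -> R) i : F i <= nneg_max F.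
Proof. exact: le_bigmax. Qed.

Theorem theorem7p2 (R : realType) (d n : nat) (n_gt0 : (0 < n)%N) :
  (forall (Sigma : 'M[R]_d) (p : 'I_n -> R) (mu : 'I_n -> 'cV[R]_d),
     pdmx Sigma -> (forall i, 0 < p i) -> \sum_(i < n) p i = 1 ->
     let f := gauss_mix Sigma p mu in
     let C := post_cov Sigma p mu in
     [/\ twice_diff (fun x => ln (f x)),
         forall x, hessian (fun y => ln (f y)) x =
                   - invmx Sigma + invmx Sigma *m C x *m invmx Sigma,
         (forall x, loewner_le (C x) Sigma) -> log_concave f,
         (forall x, loewner_lt (C x) Sigma) -> strictly_log_concave f &
         (exists c : 'cV[R]_d,
            nneg_max (fun i => sqnorm (sqrtmx (invmx Sigma) *m (mu i - c))) < 1) ->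
         strictly_log_concave f]) /\
  (forall X : 'I_n -> 'cV[R]_d,
     (forall (c : 'cV[R]_d) (r t : R),
        0 <= r -> nneg_max (fun i => sqnorm (X i - c)) <= r ^+ 2 -> r ^+ 2 < t ->
        [/\ strictly_log_concave (heat_kde X t),
            exists! m, is_mode (heat_kde X t) m &
            forall l, 0 < l -> convex_set (superlevel (heat_kde X t) l)]) /\
     (forall t : R,
        pdmx (sample_cov X) -> 0 < t ->
        ln (1 + mahalanobis_radius2 X) / 2 < t ->
        [/\ strictly_log_concave (ou_path X t),
            exists! m, is_mode (ou_path X t) m &
            forall l, 0 < l -> convex_set (superlevel (ou_path X t) l)])).
Proof.
(* The index argument gives this the form of the positivity hypothesis on the weights. *)
have n1_gt0 (i : 'I_n) : 0 < n%:R^-1 :> R by rewrite invr_gt0 ltr0n.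
split=> [Sigma p mu pS p_gt0 _ /=|X]; first split.
- exact: twice_diff_ln_gauss_mix.
- exact: hessian_ln_gauss_mix.
- exact: gauss_mix_log_concave.
- exact: gauss_mix_strictly_log_concave.
- move=> [c cmu].
  have muc i : qform (invmx Sigma) (mu i - c) < 1.
    rewrite -(sqnorm_sqrtmx _ (pdmx_inv pS)).
    exact: le_lt_trans (le_nneg_max _ i) cmu.
  by have [] := gauss_mix_unimodal n_gt0 pS p_gt0 muc.
split=> [c r t r0 Xc rt|t pS t0 Xt].
- have t0 : 0 < t by apply: le_lt_trans rt; exact: sqr_ge0.
  have -> : heat_kde X t = gauss_mix t%:M (fun=> n%:R^-1) X.
    by apply/funext => x; rewrite /heat_kde mulr_sumr.
  have p1 := @pdmx1 R d.
  have tE : t%:M = t *: 1%:M :> 'M[R]_d by rewrite scalemx1.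
  apply: (@gauss_mix_unimodal _ _ _ _ _ _ c) => //.
    by rewrite tE; exact: pdmxZ.
  (* With covariance t I the squared Mahalanobis distance is the squared Euclidean distance divided
     by [t]. *)
  move=> i; rewrite tE invmxZr ?unitmx1 ?gt_eqF // invmx1 qformE.
  rewrite -scalemxAl mul1mx dotpZr mulrC ltr_pdivrMr // mul1r.
  exact: le_lt_trans (le_trans (le_nneg_max _ i) Xc) rt.
set S := sample_cov X in pS *; set m := sample_mean X.
have e2 : expR (- (2 * t)) = expR (- t) ^+ 2.
  by rewrite expr2 -expRD; congr expR; ring.
have s0 : 0 < 1 - expR (- (2 * t)).
  by rewrite subr_gt0 expR_lt1 oppr_lt0 mulr_gt0.
have -> : ou_path X t = gauss_mix ((1 - expR (- (2 * t))) *: S) (fun=> n%:R^-1)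
    (fun i => m + expR (- t) *: (X i - m)).
  apply/funext => x; rewrite /ou_path mulr_sumr; apply: eq_bigr => i _.
  by rewrite opprD addrA.
(* With q the form of [invmx S] at [X i - m], the condition about the centre [m] is e^(-2t) q < 1 -
   e^(-2t), that is (1 + q) e^(-2t) < 1. *)
apply: (@gauss_mix_unimodal _ _ _ _ _ _ m) => //; first exact: pdmxZ.
move=> i; rewrite (addrC m) addrK invmxZr ?pdmx_unit ?gt_eqF // qformE.
rewrite -scalemxAl -scalemxAr !dotpZr dotpZl -qformE.
have XR : qform (invmx S) (X i - m) <= mahalanobis_radius2 X.
  exact: (le_nneg_max (fun i => qform (invmx S) (X i - m))).
have q0 : 0 <= qform (invmx S) (X i - m).
  by apply: pdmx_qform_ge0; exact: pdmx_inv.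
have R0 : 0 < 1 + mahalanobis_radius2 X by rewrite ltr_wpDr // (le_trans q0).
(* This is the lower bound on [t] in exponential form. *)
have RE : (1 + mahalanobis_radius2 X) * expR (- (2 * t)) < 1.
  rewrite expRN ltr_pdivrMr ?expR_gt0 // mul1r -ltr_ln ?posrE ?expR_gt0 // expRK.
  by rewrite mulrC -ltr_pdivrMr.
rewrite mulrC ltr_pdivrMr // mul1r.
have := expR_gt0 (- (2 * t)); rewrite e2 in RE s0 *.
by clear n1_gt0; nra.
Qed.
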